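(* Let $I=[0,1]$ and $F=F_{\{1/2,3,1\}}=\{(x,3x):x\in[0,\tfrac13]\}\cup\{(x,\tfrac x2):x\in[0,1]\}\cup\{(x,x):x\in[0,1]\}\subseteq I^2$. Then the dynamical system $(I_F^+,\sigma_F^+)$ does not have the shadowing property.
   Context: $I_F^+=\{(x_1,x_2,\ldots)\in I^{\mathbb N}: (x_i,x_{i+1})\in F\ \forall i\ge 1\}$, with metric $D(\mathbf x,\mathbf y)=\sup_{i\ge1}|x_i-y_i|/2^i$, and $\sigma_F^+(x_1,x_2,\ldots)=(x_2,x_3,\ldots)$. Let $(Y,f)$ be a dynamical system ($Y$ compact metric with metric $d$, $f:Y\to Y$ continuous). For $\delta>0$, a sequence $(x_0,x_1,\ldots)$ in $Y$ is a $\delta$-pseudo-orbit if $d(f(x_n),x_{n+1})<\delta$ for every $n\ge0$. $(Y,f)$ has the shadowing property if for each $\varepsilon>0$ there is $\delta>0$ such that for each $\delta$-pseudo-orbit $(x_k)_{k\ge 0}$ there is $y\in Y$ with $d(f^k(y),x_k)<\varepsilon$ for all $k\ge 0$. *)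

(* Defs.v *)
From HB Require Import structures.
From mathcomp Require Import all_boot all_order all_algebra.
From mathcomp Require Import lra.
From mathcomp Require Import all_classical all_reals all_analysis.
Import Order.TTheory GRing.Theory Num.Theory.
Import numFieldNormedType.Exports.

Set Implicit Arguments.
Unset Strict Implicit.
Unset Printing Implicit Defensive.

Local Open Scope classical_set_scope.
Local Open Scope ring_scope.

Definition pseudo_orbit (R : realType) (Y : metricType R) (f : Y -> Y)
    (delta : R) (x : nat -> Y) : Prop :=
  forall n, mdist (f (x n)) (x n.+1) < delta.

(* [shadowing] does not carry the compactness of the space or the continuity of
   the map: for Mahavier products over a closed relation they are proved in
   [mahavier_compact] and [mahavier_shift_continuous]. *)
Definition shadowing (R : realType) (Y : metricType R) (f : Y -> Y) : Prop :=
  forall eps : R, 0 < eps ->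
    exists2 delta : R, 0 < delta &
      forall x : nat -> Y, pseudo_orbit f delta x ->
        exists y : Y, forall k, mdist (iter k f y) (x k) < eps.

(* The Mahavier product of F over [0, 1].  Sequences are indexed from 0: the
   entry x_i of the usual 1-based notation is [coordinate x i.-1], which
   accounts for the exponent [i.+1] in [mahavier_dist]. *)
Record mahavier (R : realType) (F : set (R * R)) : Type := Mahavier {
  coordinate : nat -> R ;
  coordinate_itv : forall i, `[0, 1]%classic (coordinate i) ;
  coordinate_rel : forall i, F (coordinate i, coordinate i.+1) }.

HB.instance Definition _ (R : realType) (F : set (R * R)) :=
  gen_eqMixin (mahavier F).
HB.instance Definition _ (R : realType) (F : set (R * R)) :=
  gen_choiceMixin (mahavier F).

Definition mahavier_shift (R : realType) (F : set (R * R)) (x : mahavier F) :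
    mahavier F :=
  Mahavier (fun i => coordinate_itv x i.+1) (fun i => coordinate_rel x i.+1).
Arguments mahavier_shift {R} F x.

Section mahavier_metric.
Context (R : realType) (F : set (R * R)).
Implicit Types x y z : mahavier F.

Lemma coordinate_inj : injective (@coordinate R F).
Proof.
move=> [u u1 u2] [v v1 v2] /= uv; rewrite -uv in v1 v2 *.
by rewrite (Prop_irrelevance u1 v1) (Prop_irrelevance u2 v2).
Qed.

Definition mahavier_dist x y : R :=
  sup (range (fun i => `|coordinate x i - coordinate y i| / 2 ^+ i.+1)).

Local Definition term x y i : R := `|coordinate x i - coordinate y i| / 2 ^+ i.+1.

Lemma term_le_inv x y i : term x y i <= (2 ^+ i.+1)^-1.
Proof.
have := coordinate_itv x i; have := coordinate_itv y i.
rewrite /= !in_itv/= => /andP[y0 y1] /andP[x0 x1].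
rewrite /term -[leRHS]mul1r ler_wpM2r ?invr_ge0 ?exprn_ge0//.
by rewrite ler_norml; apply/andP; split; lra.
Qed.

Lemma mahavier_dist_has_sup x y : has_sup (range (term x y)).
Proof.
split; first by exists (term x y 0%N); exists 0%N.
exists 1 => _ [i _ <-]; apply: le_trans (term_le_inv x y i) _.
by rewrite invf_le1 ?exprn_gt0// exprn_ege1// ler1n.
Qed.

Lemma term_le_dist x y i : term x y i <= mahavier_dist x y.
Proof.
by apply: sup_upper_bound; [exact: mahavier_dist_has_sup | exists i].
Qed.

Lemma dist_le x y (e : R) :
  (forall i, term x y i <= e) -> mahavier_dist x y <= e.
Proof.
move=> le_e; apply: ge_sup; first by exists (term x y 0%N); exists 0%N.
by move=> _ [i _ <-]; exact: le_e.
Qed.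

Lemma mahavier_distxx x : mahavier_dist x x = 0.
Proof.
apply/eqP; rewrite eq_le; apply/andP; split.
  by apply: dist_le => i; rewrite /term subrr normr0 mul0r.
by have := term_le_dist x x 0%N; rewrite /term subrr normr0 mul0r.
Qed.

Lemma mahavier_dist_positivity x y : mahavier_dist x y = 0 -> x = y.
Proof.
move=> d0; apply/coordinate_inj/funext => i; apply/eqP; rewrite -subr_eq0 -normr_le0.
have := term_le_dist x y i.
by rewrite d0 /term pmulr_lle0 // invr_gt0 exprn_gt0.
Qed.

Lemma mahavier_dist_sym x y : mahavier_dist x y = mahavier_dist y x.
Proof.
by rewrite /mahavier_dist; under eq_fun do rewrite distrC.
Qed.

Lemma mahavier_dist_triangle y x z :
  mahavier_dist x z <= mahavier_dist x y + mahavier_dist y z.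
Proof.
apply: dist_le => i; have := lerD (term_le_dist x y i) (term_le_dist y z i).
apply: le_trans; rewrite /term -mulrDl.
by rewrite ler_wpM2r ?invr_ge0 ?exprn_ge0// ler_distD.
Qed.

HB.instance Definition _ := isMetric.Build R (mahavier F)
  mahavier_distxx mahavier_dist_positivity
  mahavier_dist_sym mahavier_dist_triangle.

End mahavier_metric.

Lemma fmap_ultra (T U : Type) (f : T -> U) (G : set_system T) :
  UltraFilter G -> UltraFilter (f @ G).
Proof.
move=> GU; split=> [|H HP GH]; first exact: fmap_proper_filter.
apply/seteqP; split=> // A HA.
have [//|GA] := in_ultra_setVsetC (f @^-1` A) GU.
have HC : H (~` A) by exact: GH.
by have [u []] := filter_ex (filterI HA HC).
Qed.

Lemma mahavier_compact (R : realType) (F : set (R * R)) :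
  closed F -> compact [set: mahavier F].
Proof.
move=> clF; rewrite compact_ultra => U UU _.
have lim_coord i : exists2 l : R, `[0, 1]%classic l &
    (fun x : mahavier F => coordinate x i) @ U --> l.
  have := @segment_compact R 0 1; rewrite compact_ultra => cpt.
  have := cpt ((fun x : mahavier F => coordinate x i) @ U) (fmap_ultra _ UU).
  case=> [|l [l01 Ul]]; last by exists l.
  by apply: (@filterE _ U) => x; exact: (coordinate_itv x i).
pose l i := s2val (cid2 (lim_coord i)).
have l01 i : `[0, 1]%classic (l i) by exact: (s2valP (cid2 (lim_coord i))).
have Ul i : (fun x : mahavier F => coordinate x i) @ U --> l i.
  exact: (s2valP' (cid2 (lim_coord i))).
have lF i : F (l i, l i.+1).
  have Ull : (fun x : mahavier F => (coordinate x i, coordinate x i.+1)) @ U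
      --> (l i, l i.+1) by
    exact: (@cvg_pair _ _ _ U (nbhs (l i)) (nbhs (l i.+1)) _ _ _
      (fun x : mahavier F => coordinate x i)
      (fun x => coordinate x i.+1) (Ul i) (Ul i.+1)).
  apply: (closed_cvg (F : _ -> Prop) clF _ _ Ull).
  by apply: (@filterE _ U) => x; exact: (coordinate_rel x i).
exists (Mahavier l01 lF); split=> //.
apply/fcvg_ballP => e e0.
have e20 : 0 < e / 2 by rewrite divr_gt0.
have [N Ne] : exists N, (2 ^+ N.+1)^-1 <= e / 2.
  exists (Num.bound (e / 2)^-1); rewrite invf_ple ?posrE ?exprn_gt0//.
  by rewrite ltW// upper_nthrootP.
have small i : \forall x \near U, term (Mahavier l01 lF) x i <= e / 2.
  have /cvg_ballP/(_ _ e20) := Ul i.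
  apply: filterS => x; rewrite /ball /= => lx.
  rewrite /term ler_pdivrMr ?exprn_gt0// (le_trans (ltW lx))//.
  by rewrite ler_peMr ?(ltW e20)// exprn_ege1// ler1n.
have smallN : \forall x \near U, forall i : 'I_N,
    term (Mahavier l01 lF) x i <= e / 2.
  by apply: filter_forall => i; exact: small.
apply: filterS smallN => x xN; rewrite ballEmdist /=.
apply: (@le_lt_trans _ _ (e / 2)); last by rewrite ltr_pdivrMr// ltr_pMr// ltr1n.
apply: dist_le => i; have [iN|Ni] := ltnP i N; first exact: (xN (Ordinal iN)).
apply: le_trans (term_le_inv _ x i) _; apply: le_trans Ne.
by rewrite lef_pV2 ?posrE ?exprn_gt0// ler_eXn2l ?ltr1n.
Qed.

Lemma mahavier_shift_continuous (R : realType) (F : set (R * R)) :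
  continuous (mahavier_shift F).
Proof.
move=> x.
apply: (proj2 (@cvg_ballP R _ _ (nbhs x) (nbhs_filter x) _ _)) => e e0.
apply/nbhs_ballP; exists (e / 2) => /=; first by rewrite divr_gt0.
move=> y; rewrite !ballEmdist /= => xy.
apply: le_lt_trans (_ : mdist x y * 2 < e); last by rewrite -ltr_pdivlMr.
apply: dist_le => i.
rewrite -ler_pdivrMr//; have := term_le_dist x y i.+1.
by apply: le_trans; rewrite -mulrA -invfM -exprSr.
Qed.

Definition F_half_3_1 (R : realType) : set (R * R) :=
  [set (x, 3 * x) | x in `[0, 1 / 3]%classic] `|`
  [set (x, x / 2) | x in `[0, 1]%classic] `|`
  [set (x, x) | x in `[0, 1]%classic].
Arguments F_half_3_1 : clear implicits.

Lemma F_half_3_1_closed (R : realType) : closed (F_half_3_1 R).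
Proof.
have clg (a b : R) : closed [set (x, b * x) | x in `[0, a]%classic].
  apply: compact_closed; first exact: norm_hausdorff.
  apply: continuous_compact; last exact: segment_compact.
  apply: continuous_subspaceT => x.
  apply: (@cvg_pair _ _ _ (nbhs x) (nbhs x) (nbhs (b * x)) _ _ _ id ( *%R b)).
    exact: cvg_id.
  exact: mulrl_continuous.
apply: closedU; first apply: closedU.
- exact: clg.
- suff -> : [set (x, x / 2 : R) | x in `[0, 1]%classic] =
            [set (x, 2^-1 * x) | x in `[0, 1]%classic] by exact: clg.
  by apply: eq_imagel => x _; rewrite mulrC.
- suff -> : [set (x, x : R) | x in `[0, 1]%classic] =
            [set (x, 1 * x) | x in `[0, 1]%classic] by exact: clg.
  by apply: eq_imagel => x _; rewrite mul1r.
Qed.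

(* Main.v *)
(* For each [x] in [0, 1] the constant sequence x is a fixed point of the shift,
   since F contains the diagonal.  Letting x climb from 1/2 to 1 in steps of at
   most delta gives a pseudo-orbit.  An orbit that stays close to it has all its
   entries near or above 1/2 and varying slowly, so it can use neither the branch
   [3 x] (which requires x <= 1/3) nor the branch [x / 2]; it is therefore
   constant, and cannot be close to both 1/2 and 1. *)
Require Import Defs.
From mathcomp Require Import all_boot all_order all_algebra.
From mathcomp Require Import lra.
From mathcomp Require Import all_classical all_reals all_analysis.
Import Order.TTheory GRing.Theory Num.Theory.

Set Implicit Arguments.
Unset Strict Implicit.
Unset Printing Implicit Defensive.

Local Open Scope classical_set_scope.
Local Open Scope ring_scope.

Lemma F_half_3_1P (R : realType) (x y : R) : F_half_3_1 R (x, y) ->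
  [\/ x <= 1 / 3, y = x / 2 | y = x].
Proof.
case=> [[|]|] [t t01 [<- <-]]; last 2 first.
- exact: Or32.
- exact: Or33.
by apply: Or31; move: t01; rewrite /= in_itv/= => /andP[].
Qed.

Lemma F_half_3_1_diag (R : realType) (x : R) :
  `[0, 1]%classic x -> F_half_3_1 R (x, x).
Proof. by move=> x01; right; exists x. Qed.

Definition const_seq (R : realType) (x : R) (x01 : `[0, 1]%classic x) :
    mahavier (F_half_3_1 R) :=
  Mahavier (fun=> x01) (fun=> F_half_3_1_diag x01).

Lemma coordinate_iter_shift (R : realType) (F : set (R * R)) (x : mahavier F) k i :
  coordinate (iter k (mahavier_shift F) x) i = coordinate x (k + i).
Proof. by elim: k i => // k IH i; rewrite iterS /= IH addnS. Qed.

Lemma coordinate0_lt_mdist (R : realType) (F : set (R * R)) (x y : mahavier F)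
    (e : R) :
  mdist x y < e -> `|coordinate x 0 - coordinate y 0| < 2 * e.
Proof.
move=> xy; rewrite mulrC -ltr_pdivrMr//; apply: le_lt_trans xy.
exact: (term_le_dist x y 0).
Qed.

Lemma mdist_const_seq_le (R : realType) (x y : R) (x01 : `[0, 1]%classic x)
    (y01 : `[0, 1]%classic y) :
  mdist (const_seq x01) (const_seq y01) <= `|x - y| / 2.
Proof.
apply: dist_le => i /=.
(* The weight [1 / 2 ^+ i.+1] is largest at [i = 0]. *)
by rewrite ler_wpM2l// lef_pV2 ?posrE ?exprn_gt0// ler_eXnr// ler1n.
Qed.

Definition climb (R : realType) (d : R) (n : nat) : R :=
  Num.min 1 (1 / 2 + n%:R * d).

Section climb.
Context (R : realType) (d : R).
Hypothesis d0 : 0 < d.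

Lemma climb_ge n : 1 / 2 <= climb d n.
Proof.
have nd : 0 <= n%:R * d by rewrite mulr_ge0// ltW.
by rewrite /climb le_min; apply/andP; split; lra.
Qed.

Lemma climb_itv n : `[0, 1]%classic (climb d n).
Proof.
rewrite /= in_itv/= ge_min lexx/= andbT.
by apply: le_trans (climb_ge n); lra.
Qed.

Lemma climb_step n : climb d n <= climb d n.+1 <= climb d n + d.
Proof.
have dpos := d0; rewrite /climb -(natr1 n) mulrDl mul1r /Num.min.
by case: ltP => ?; case: ltP => ?; apply/andP; split; lra.
Qed.

Lemma climb0 : climb d 0 = 1 / 2.
Proof. by rewrite /climb mul0r addr0 min_r//; lra. Qed.

Lemma climb_eq1 : exists n, climb d n = 1.
Proof.
(* More than [d^-1] steps of length [d] exceed 1, hence the height 1/2 to be climbed. *)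
exists (Num.bound d^-1); rewrite /climb min_l//.
suff : 1 < (Num.bound d^-1)%:R * d by lra.
rewrite -ltr_pdivrMr// mul1r; apply: archi_boundP.
by rewrite invr_ge0 ltW.
Qed.

Lemma climb_pseudo_orbit :
  pseudo_orbit (mahavier_shift (F_half_3_1 R)) d
    (fun n => const_seq (climb_itv n)).
Proof.
(* The shift of a constant sequence is convertible to that sequence, so only the step of the climb
   counts. *)
move=> n; apply: le_lt_trans (mdist_const_seq_le (climb_itv n) (climb_itv n.+1)) _.
rewrite ltr_pdivrMr// ltr_norml; have := d0; have /andP[] := climb_step n.
by move=> *; apply/andP; split; lra.
Qed.

(** Tripling fails since [y n > 1/2 - 1/10 > 1/3]. Halving fails since the climb is nondecreasing:
    with [c = climb d n] it would give [c - 1/10 < (c + 1/10) / 2], that is [c < 3/10]. *)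
Lemma near_climb_constant (y : nat -> R) :
  (forall n, F_half_3_1 R (y n, y n.+1)) ->
  (forall n, `|y n - climb d n| < 1 / 10) ->
  forall n, y n = y 0.
Proof.
move=> yF yc; elim=> // n <-.
have := yc n; have := yc n.+1; rewrite !ltr_norml => /andP[? ?] /andP[? ?].
have /andP[? _] := climb_step n; have := climb_ge n.
by case: (F_half_3_1P (yF n)) => //; lra.
Qed.

End climb.

Theorem theorem5p19 (R : realType) : ~ shadowing (mahavier_shift (F_half_3_1 R)).
Proof.
(* Coordinate 0 has weight 1/2, so 1/20 in the metric becomes the tolerance 1/10 on entries. *)
have e0 : 0 < 1 / 20 :> R by lra.
move=> /(_ _ e0)[d d0 /(_ _ (climb_pseudo_orbit d0))[y yP]].
have yc n : `|coordinate y n - climb d n| < 1 / 10.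
  have := coordinate0_lt_mdist (yP n).
  rewrite coordinate_iter_shift addn0 => /lt_le_trans; apply.
  by lra.
have [n c1] := climb_eq1 d0.
have := near_climb_constant d0 (coordinate_rel y) yc n.
have := yc n; have := yc 0; rewrite climb0 c1 !ltr_norml.
by move=> /andP[? ?] /andP[? ?]; lra.
Qed.
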